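(* Let $I\subset\mathbb{R}$ be a nonempty compact set, let $f:\mathbb{R}\to\mathbb{R}$ be continuous, and let $g_0,\dots,g_n,h_0,\dots,h_m$ be real-valued continuous functions on $I$. Write $\mathbf g(t)=(g_0(t),\dots,g_n(t))$, $\mathbf h(t)=(h_0(t),\dots,h_m(t))$, $$C=\{(\mathbf a,\mathbf b)\in\mathbb{R}^{n+1}\times\mathbb{R}^{m+1}:\langle \mathbf b,\mathbf h(t)\rangle\ge 1\ \ \forall t\in I\},\qquad \Psi^f(\mathbf a,\mathbf b)=\sup_{t\in I}\left|f(t)-\frac{\langle\mathbf a,\mathbf g(t)\rangle}{\langle\mathbf b,\mathbf h(t)\rangle}\right|.$$ Then $\Psi^f$ is pseudo-convex on $C$ (in the nonsmooth sense of Penot and Quang, with respect to the Clarke subdifferential). Consequently the Clarke subdifferential $\partial\Psi^f$ is a pseudo-monotone operator on $C$.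
   Context: The function $\Psi^f$ is well defined and locally Lipschitz on the open set $U=\{(\mathbf a,\mathbf b):\langle\mathbf b,\mathbf h(t)\rangle>0\ \forall t\in I\}\supset C$, and $\partial\Psi^f(x)$ denotes its Clarke subdifferential at $x=(\mathbf a,\mathbf b)$. With $\sigma^f_t(\mathbf a,\mathbf b)=f(t)-\frac{\langle\mathbf a,\mathbf g(t)\rangle}{\langle\mathbf b,\mathbf h(t)\rangle}$, $A^+(x)=\{t\in I:\Psi^f(x)=\sigma^f_t(x)\}$ and $A^-(x)=\{t\in I:\Psi^f(x)=-\sigma^f_t(x)\}$, it is given by $\partial\Psi^f(x)=\mathrm{conv}\{\nabla\sigma^f_t(x),\,-\nabla\sigma^f_l(x): t\in A^+(x),\ l\in A^-(x)\}$, where $\nabla$ is the gradient with respect to $(\mathbf a,\mathbf b)$. Pseudo-convexity (Penot–Quang) on $C$: for all $x,y\in C$, if there exists $u\in\partial\Psi^f(x)$ with $\langle u,y-x\rangle\ge0$, then $\Psi^f(x)\le\Psi^f(y)$. Pseudo-monotonicity of a point-to-set operator $T$ on $C$: for all $x,y\in C$, $u\in T(x)$, $v\in T(y)$, $\langle u,y-x\rangle\ge 0$ implies $\langle v,y-x\rangle\ge0$. *)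

(* Defs.v *)
From mathcomp Require Import all_boot all_order all_algebra.
From mathcomp Require Import all_classical all_reals all_analysis.
Set Implicit Arguments.
Unset Strict Implicit.
Unset Printing Implicit Defensive.
Import Order.TTheory GRing.Theory Num.Theory numFieldNormedType.Exports.
Local Open Scope classical_set_scope.
Local Open Scope ring_scope.

Definition dot (R : realType) (k : nat) (u v : 'rV[R]_k) : R :=
  \sum_(i < k) u 0 i * v 0 i.

(* R^(n+1) x R^(m+1); the library norm on it is a max norm, which induces the
   usual topology. *)
Definition coef (R : realType) (n m : nat) : normedModType R :=
  ('rV[R]_n.+1 * 'rV[R]_m.+1)%type.

Definition pairing (R : realType) (n m : nat) (u v : coef R n m) : R :=
  dot u.1 v.1 + dot u.2 v.2.

(* The generalized directional derivative of Clarke,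
   limsup_{y -> x, s -> 0+} (F (y + s v) - F y) / s.
   It depends only on the restriction of F to a neighbourhood of x. *)
Definition clarke_dderiv (R : realType) (V : normedModType R) (F : V -> R)
    (x v : V) : \bar R :=
  limf_esup (fun p : V * R => ((F (p.1 + p.2 *: v) - F p.1) / p.2)%:E)
            (filter_prod (nbhs x) (0 : R)^'+).

(* Linear forms are identified with vectors through the Euclidean pairing. *)
Definition clarke_subdiff (R : realType) (n m : nat) (F : coef R n m -> R)
    (x : coef R n m) : set (coef R n m) :=
  [set u | forall v, ((pairing u v)%:E <= clarke_dderiv F x v)%E].

Definition pseudo_convex_on (R : realType) (n m : nat) (C : set (coef R n m))
    (F : coef R n m -> R) : Prop :=
  forall x y, C x -> C y ->
    (exists2 u, clarke_subdiff F x u & 0 <= pairing u (y - x)) -> F x <= F y.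

Definition pseudo_monotone_on (R : realType) (n m : nat)
    (C : set (coef R n m)) (T : coef R n m -> set (coef R n m)) : Prop :=
  forall x y u v, C x -> C y -> T x u -> T y v ->
    0 <= pairing u (y - x) -> 0 <= pairing v (y - x).

Definition fvec (R : realType) (k : nat) (g : 'I_k -> R -> R) (t : R) :
  'rV[R]_k := \row_i g i t.

Definition feasible (R : realType) (n m : nat) (I : set R)
    (h : 'I_m.+1 -> R -> R) : set (coef R n m) :=
  [set x | forall t, I t -> 1 <= dot x.2 (fvec h t)].

(* [sup] is the supremum in R, with the value 0 when the set is empty or
   unbounded above. For I compact and nonempty and f, g, h continuous, neither
   happens on the open set where <b, h(t)> > 0 for all t in I, which contains
   [feasible I h]. *)
Definition Psi (R : realType) (n m : nat) (I : set R) (f : R -> R)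
    (g : 'I_n.+1 -> R -> R) (h : 'I_m.+1 -> R -> R) (x : coef R n m) : R :=
  sup [set `|f t - dot x.1 (fvec g t) / dot x.2 (fvec h t)| | t in I].

(* Main.v *)
(* Each error f - <a, g(t)> / <b, h(t)> is a quotient of affine functions of
   x = (a, b), so from p to p + s (q - p) it moves by a convex combination of
   its values at p and q, and the weight of q lies between s / K and K s, with K
   uniform in t and in p, q near x, y.  Hence (Psi(p + s (y - x)) - Psi(p)) / s
   is at most max(r / K, K r) for p near x and any r > Psi(y) - Psi(x), which
   bounds Clarke's derivative of Psi at x along y - x: it is negative if
   Psi(y) < Psi(x) and nonpositive if Psi(y) <= Psi(x).  The first case is
   pseudo-convexity.  For pseudo-monotonicity, the element of the
   subdifferential at x gives Psi(x) <= Psi(y), and the second case, at y along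
   x - y, bounds the pairing of x - y with the subdifferential at y. *)
Require Import Defs.
From mathcomp Require Import all_boot all_order all_algebra.
From mathcomp Require Import all_classical all_reals all_analysis.
From mathcomp Require Import ring lra.
Import Order.TTheory GRing.Theory Num.Theory numFieldNormedType.Exports.
Local Open Scope classical_set_scope.
Local Open Scope ring_scope.

(** * Pairings with continuous functions, uniformly on a compact set *)

Section Dot.
Variables (R : realType) (k : nat).
Implicit Types u v w : 'rV[R]_k.

Lemma dotDl u v w : dot (u + v) w = dot u w + dot v w.
Proof. by rewrite /dot -big_split; apply: eq_bigr => i _; rewrite mxE mulrDl. Qed.

Lemma dotZl a u w : dot (a *: u) w = a * dot u w.
Proof. by rewrite /dot mulr_sumr; apply: eq_bigr => i _; rewrite mxE mulrA. Qed.

Lemma dotNr u w : dot u (- w) = - dot u w.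
Proof. by rewrite /dot -sumrN; apply: eq_bigr => i _; rewrite mxE mulrN. Qed.

Lemma dotBl u v w : dot (u - v) w = dot u w - dot v w.
Proof. by rewrite dotDl -scaleN1r dotZl mulN1r. Qed.

(** The norm on row vectors is the maximum norm, so each of the [k] products is at most [B] times
    the norm of [u]. *)
Lemma ler_norm_dot B u w : (forall i, `|w 0 i| <= B) ->
  `|dot u w| <= k%:R * B * `|u|.
Proof.
move=> wB; apply: (le_trans (ler_norm_sum _ _ _)).
have uE i : `|u 0 i| <= `|u|.
  rewrite [leRHS]/Num.norm /= mx_normrE.
  exact: (le_bigmax _ (fun ij : 'I_1 * 'I_k => `|u ij.1 ij.2|) (0, i)).
apply: (@le_trans _ _ (\sum_(i < k) B * `|u|)).
  by apply: ler_sum => i _; rewrite normrM mulrC ler_pM.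
by rewrite sumr_const card_ord -mulrA mulr_natl.
Qed.

End Dot.

Lemma compact_norm_bounded (R : realType) (I : set R) (p : R -> R) :
  compact I -> {within I, continuous p} ->
  exists2 B, 0 < B & forall t, I t -> `|p t| <= B.
Proof.
move=> Ic pc; have [M [_ HM]] := compact_bounded (continuous_compact pc Ic).
exists (`|M| + 1); first by rewrite ltr_wpDl.
by move=> t It; apply: (HM (`|M| + 1)) => //=;
  [rewrite ltr_pwDr// ler_norm|exists t].
Qed.

Lemma compact_dot_fvec_bounded (R : realType) (k : nat) (I : set R)
    (p : 'I_k -> R -> R) :
  compact I -> (forall i, {within I, continuous (p i)}) ->
  exists2 M, 0 < M & forall u t, I t -> `|dot u (fvec p t)| <= M * `|u|.
Proof.
move=> Ic pc.
have /choice[B HB] : forall i, exists B, 0 < B /\ forall t, I t -> `|p i t| <= B.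
  by move=> i; have [B B0 HB] := compact_norm_bounded _ _ _ Ic (pc i); exists B.
(* The sum dominates every [B i]; the [+ 1] keeps the constant positive when [k = 0]. *)
exists (k%:R * \sum_i B i + 1).
  rewrite ltr_wpDl// mulr_ge0// sumr_ge0// => i _.
  by rewrite ltW//; case: (HB i).
move=> u t It; apply: (@le_trans _ _ (k%:R * (\sum_i B i) * `|u|)).
  apply: ler_norm_dot => i; rewrite mxE (le_trans ((HB i).2 t It))//.
  rewrite (bigD1 i)//= lerDl sumr_ge0// => j _.
  by rewrite ltW//; case: (HB j).
by rewrite ler_wpM2r// lerDl.
Qed.

Lemma dot_fvec_equicontinuous (R : realType) (k : nat) (I : set R)
    (p : 'I_k -> R -> R) (u : 'rV[R]_k) (e : R) :
  compact I -> (forall i, {within I, continuous (p i)}) -> 0 < e ->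
  \forall v \near u, forall t, I t ->
    `|dot v (fvec p t) - dot u (fvec p t)| <= e.
Proof.
move=> Ic pc e0; have [M M0 HM] := compact_dot_fvec_bounded _ _ _ _ Ic pc.
near=> v; move=> t It; rewrite -dotBl (le_trans (HM _ _ It))//.
rewrite mulrC -ler_pdivlMr// distrC ltW//.
near: v; apply: cvgr_dist_lt; first exact: cvg_id.
by rewrite divr_gt0.
Unshelve. all: by end_near. Qed.

Lemma near_fst (T U : topologicalType) (x : T * U) (P : set T) :
  (\forall u \near x.1, P u) -> \forall p \near x, P p.1.
Proof. by move=> xP; exact: (cvg_fst (F := nbhs x.1) (G := nbhs x.2) xP). Qed.

Lemma near_snd (T U : topologicalType) (x : T * U) (P : set U) :
  (\forall u \near x.2, P u) -> \forall p \near x, P p.2.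
Proof. by move=> xP; exact: (cvg_snd (F := nbhs x.1) (G := nbhs x.2) xP). Qed.

Lemma limf_esup_le (R : realType) (T : choiceType) (X : filteredType T)
    (f : X -> \bar R) (F : set_system X) (c : \bar R) :
  (\forall p \near F, (f p <= c)%E) -> (limf_esup f F <= c)%E.
Proof.
move=> fc; apply: ereal_inf_le; exists (ereal_sup (f @` [set p | (f p <= c)%E])).
  by exists [set p | (f p <= c)%E].
by apply: ge_ereal_sup => _ [p /= + <-].
Qed.

(* Along a segment a quotient of affine functions moves by a convex
   combination of its end values; the denominators set the weight of the far
   end, [s * D' / ((1 - s) * D + s * D')]. *)
Lemma segment_quotient_le (R : realFieldType) (a N D N' D' s P Q r K : R) :
  0 < s -> s < 1 -> 2^-1 <= D -> D <= K -> 2^-1 <= D' -> D' <= K ->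
  `|a - N / D| <= P -> `|a - N' / D'| <= Q -> Q - P <= r ->
  `|a - ((1 - s) * N + s * N') / ((1 - s) * D + s * D')| <=
    P + s * Num.max ((2 * K)^-1 * r) (2 * K * r).
Proof.
move=> s0 s1 D2 DK D'2 D'K HP HQ Qr.
set E := (1 - s) * D + s * D'.
have [D0 D'0 K0] : [/\ 0 < D, 0 < D' & 0 < K] by split; lra.
have E2 : 2^-1 <= E by rewrite /E; nra.
have EK : E <= K by rewrite /E; nra.
have E0 : 0 < E by lra.
have -> : a - ((1 - s) * N + s * N') / E =
    (1 - s * D' / E) * (a - N / D) + s * D' / E * (a - N' / D').
  by rewrite /E; field; rewrite !gt_eqF.
have w0 : 0 <= s * D' / E by rewrite divr_ge0 ?mulr_ge0 ?ltW.
have w1 : 0 <= 1 - s * D' / E.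
  by rewrite subr_ge0 ler_pdivrMr// mul1r /E; nra.
apply: (le_trans (ler_normD _ _)); rewrite (normrM (1 - _)) (normrM (s * D' / E)).
rewrite (ger0_norm w0) (ger0_norm w1).
apply: (@le_trans _ _ ((1 - s * D' / E) * P + s * D' / E * Q)).
  by rewrite lerD// ler_wpM2l.
have -> : (1 - s * D' / E) * P + s * D' / E * Q = P + s * (D' / E * (Q - P)).
  by field; rewrite gt_eqF.
rewrite lerD2l ler_pM2l//.
(* Both [D'] and [E] lie in [1/2, K], which bounds their ratio on both sides. The sign of [r] then
   decides which bound applies. *)
have c1 : (2 * K)^-1 <= D' / E.
  rewrite ler_pdivlMr// mulrC ler_pdivrMr; last by lra.
  nra.
have c2 : D' / E <= 2 * K by rewrite ler_pdivrMr//; nra.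
have c0 : 0 <= D' / E by rewrite divr_ge0// ltW.
apply: (@le_trans _ _ (D' / E * r)); first by rewrite ler_wpM2l.
rewrite le_max; have [r0|r0] := leP 0 r.
  by rewrite [X in _ || X]ler_wpM2r ?orbT.
by rewrite ler_wnM2r// ltW.
Qed.

(** * Continuity and Clarke derivative of the maximal error *)

Section Psi.
Variables (R : realType) (n m : nat) (I : set R) (f : R -> R).
Variables (g : 'I_n.+1 -> R -> R) (h : 'I_m.+1 -> R -> R).
Hypotheses (I_nonempty : I !=set0) (I_compact : compact I).
Hypotheses (f_cont : continuous f).
Hypotheses (g_cont : forall i, {within I, continuous (g i)}).
Hypotheses (h_cont : forall j, {within I, continuous (h j)}).
Implicit Types x y p : coef R n m.

Local Notation err p t :=
  (`|f t - dot p.1 (fvec g t) / dot p.2 (fvec h t)|).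
Local Notation Psi := (Psi I f g h).

Lemma Psi_le B p : (forall t, I t -> err p t <= B) -> Psi p <= B.
Proof.
move=> pB; apply: ge_sup => [|_ [t It <-]]; last exact: pB.
by case: I_nonempty => t It; exists (err p t); exists t.
Qed.

(** As [sup] is 0 on unbounded sets, a bound on the errors has to be exhibited; denominators away
    from 0 provide it. *)
Lemma err_le_Psi p t : (forall t, I t -> 2^-1 <= dot p.2 (fvec h t)) -> I t ->
  err p t <= Psi p.
Proof.
move=> p2 It; apply: ub_le_sup; last by exists t.
have [B _ HB] := compact_norm_bounded _ _ _ I_compact
  (continuous_subspaceT f_cont).
have [M M0 HM] := compact_dot_fvec_bounded _ _ _ _ I_compact g_cont.
exists (B + M * `|p.1| * 2) => _ [s Is <-].
apply: (le_trans (ler_normB _ _)); rewrite lerD ?HB// normrM ler_pM ?HM//.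
have := p2 _ Is; set d := dot _ _ => d2.
by rewrite normfV gtr0_norm; [rewrite -[leRHS]invrK lef_pV2 ?posrE|]; lra.
Qed.

(** Clarke's upper limit also visits infeasible points. Lowering the bound 1 to 1/2 makes room for a
    full neighbourhood. *)
Lemma feasible_near x : feasible I h x ->
  \forall p \near x, forall t, I t ->
    2^-1 <= dot p.2 (fvec h t) <= dot x.2 (fvec h t) + 1.
Proof.
move=> xC; have e0 : (0 : R) < 2^-1 by lra.
have := near_snd _ _ x _
  (dot_fvec_equicontinuous _ _ _ _ x.2 _ I_compact h_cont e0).
apply: filterS => p px t It; have := xC t It.
by move: (px t It); rewrite ler_norml => /andP[]; lra.
Qed.

Lemma Psi_near x e : feasible I h x -> 0 < e ->
  \forall p \near x, `|Psi p - Psi x| <= e.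
Proof.
move=> xC e0.
have [M M0 HM] := compact_dot_fvec_bounded _ _ _ _ I_compact g_cont.
(* Here [K] bounds the quotient at [x], and [(K + 1) * d] is [e / 2]; the other factor 2 is lost to
   the denominator [D'], which is at least 1/2. *)
pose K := M * `|x.1|; pose d := e / (2 * (K + 1)).
have K0 : 0 <= K by rewrite mulr_ge0// ltW.
have d0 : 0 < d by rewrite divr_gt0//; lra.
have pg := near_fst _ _ x _
  (dot_fvec_equicontinuous _ _ _ _ x.1 _ I_compact g_cont d0).
have ph := near_snd _ _ x _
  (dot_fvec_equicontinuous _ _ _ _ x.2 _ I_compact h_cont d0).
apply: filterS3 pg ph (feasible_near _ xC) => p pg ph pC.
have px t : I t -> `|err p t - err x t| <= e.
  move=> It; apply: (le_trans (ler_dist_dist _ _)).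
  have := HM x.1 t It; have := pg t It; have := ph t It.
  have /andP[+ _] := pC t It; have := xC t It.
  set N := dot x.1 _; set D := dot x.2 _; set N' := dot p.1 _.
  set D' := dot p.2 _ => D1 D'2 hD hN NK.
  have -> : f t - N' / D' - (f t - N / D) =
      (N / D * (D' - D) - (N' - N)) / D'.
    by field; rewrite !gt_eqF; lra.
  rewrite normrM normfV (@gtr0_norm _ D'); last by lra.
  rewrite ler_pdivrMr; last by lra.
  apply: (@le_trans _ _ (K * d + d)).
    apply: (le_trans (ler_normB _ _)); rewrite lerD// normrM ler_pM//.
    rewrite normrM normfV (@gtr0_norm _ D); last by lra.
    rewrite ler_pdivrMr; last by lra.
    by apply: (le_trans NK); rewrite ler_peMr.
  have -> : K * d + d = e / 2 by rewrite /d; field; lra.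
  by rewrite ler_pM2l.
have p2 t : I t -> 2^-1 <= dot p.2 (fvec h t) by move=> /pC/andP[].
have x2 t : I t -> 2^-1 <= dot x.2 (fvec h t) by move=> /xC; lra.
have ppx : Psi p <= Psi x + e.
  apply: Psi_le => t It; have := err_le_Psi _ _ x2 It.
  by have := px _ It; rewrite ler_norml => /andP[]; lra.
have xpx : Psi x <= Psi p + e.
  apply: Psi_le => t It; have := err_le_Psi _ _ p2 It.
  by have := px _ It; rewrite ler_norml => /andP[]; lra.
by rewrite ler_norml; lra.
Qed.

(** The constant [K] is chosen before [r], so that [r] may later tend to 0. *)
Lemma clarke_dderiv_Psi_le x y : feasible I h x -> feasible I h y ->
  exists2 K, 0 < K & forall r, Psi y - Psi x < r ->
    (clarke_dderiv Psi x (y - x)%R <= (Num.max (K^-1 * r) (K * r))%R%:E)%E.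
Proof.
move=> xC yC.
have [M M0 HM] := compact_dot_fvec_bounded _ _ _ _ I_compact h_cont.
pose K := M * `|x.2| + M * `|y.2| + 1.
have [Kx Ky] : 0 <= M * `|x.2| /\ 0 <= M * `|y.2|.
  by split; rewrite mulr_ge0// ltW.
exists (2 * K) => [|r xyr]; first by rewrite /K; lra.
(* The slack in [r] is shared equally between the variations of [Psi] near [x] and near [y]. *)
pose e := (r - (Psi y - Psi x)) / 2.
have e0 : 0 < e by rewrite /e; lra.
pose good z p := `|Psi p - Psi z| <= e /\
  forall t, I t -> 2^-1 <= dot p.2 (fvec h t) <= K.
have DK z (zC : feasible I h z) :
    M * `|z.2| + 1 <= K -> \forall p \near z, good z p.
  move=> zK; apply: filterS2 (Psi_near _ _ zC e0) (feasible_near _ zC).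
  move=> p pe pC; split=> // t It; have /andP[-> /=] := pC t It.
  by have := HM z.2 t It; rewrite ler_norml => /andP[]; lra.
have nx := DK x xC ltac:(rewrite /K; lra).
(* The far end [p + (y - x)] moves along with [p], so the direction stays [y - x]. *)
have ny : \forall p \near x, good y (p + (y - x)).
  have yK : M * `|y.2| + 1 <= K by rewrite /K; lra.
  have cy : p + (y - x) @[p --> x] --> y.
    rewrite -[X in _ --> X](subrKC x); apply: cvgD; [exact: cvg_id|exact: cvg_cst].
  exact: cy (DK y yC yK).
apply: limf_esup_le.
exists ([set p | good x p /\ good y (p + (y - x))], [set s | 0 < s < 1]).
  split=> /=; first exact: (filterI nx ny).
  by near=> s; apply/andP; split; near: s;
    [exact: nbhs_right_gt|exact: nbhs_right_lt].
move=> [p s] /= [[[px pxC] [qy qyC]] /andP[s0 s1]].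
rewrite lee_fin ler_pdivrMr// lerBlDl mulrC.
set q := p + (y - x) in qy qyC.
have pE : p + s *: (y - x) = (1 - s) *: p + s *: q.
  by rewrite /q [s *: (p + _)]scalerDr addrA -scalerDl subrK scale1r.
rewrite pE; apply: Psi_le => t It /=.
rewrite !dotDl !dotZl.
have /andP[Dp DpK] := pxC t It; have /andP[Dq DqK] := qyC t It.
apply: (segment_quotient_le _ _ _ _ _ _ _ _ (Psi q)) => //.
- by apply: err_le_Psi => // ? /pxC /andP[].
- by apply: (err_le_Psi q) => // ? /qyC /andP[].
- move: px qy; rewrite !ler_norml /e => /andP[? ?] /andP[? ?].
  by lra.
Unshelve. all: by end_near. Qed.

Lemma Psi_pseudo_convex : pseudo_convex_on (feasible I h) Psi.
Proof.
move=> x y xC yC [u ux u0]; rewrite leNgt; apply/negP => yx.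
have [K K0 HK] := clarke_dderiv_Psi_le _ _ xC yC.
(* Halving a negative gap gives a negative [r] strictly above it, and both terms of the maximum are
   then negative. *)
pose r := (Psi y - Psi x) / 2.
have r0 : r < 0 by rewrite /r; lra.
have := le_trans (ux (y - x)) (HK r ltac:(rewrite /r; lra)).
rewrite lee_fin => /(le_trans u0); apply/negP; rewrite -ltNge gt_max.
by rewrite !(pmulr_rlt0 r) ?invr_gt0// r0.
Qed.

Lemma clarke_dderiv_Psi_le0 x y : feasible I h x -> feasible I h y ->
  Psi y <= Psi x -> (clarke_dderiv Psi x (y - x)%R <= 0)%E.
Proof.
move=> xC yC yx; have [K K0 HK] := clarke_dderiv_Psi_le _ _ xC yC.
apply/lee_addgt0Pr => e e0; rewrite add0e.
(* With [r = e / c] positive, the maximum is [c * r = e]. *)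
pose c := Num.max K^-1 K; have c0 : 0 < c by rewrite lt_max K0 orbT.
apply: (le_trans (HK (e / c) _)).
  by apply: le_lt_trans (_ : 0 < _); [lra|rewrite divr_gt0].
have ec0 : 0 <= e / c by rewrite divr_ge0// ltW.
by rewrite lee_fin -maxr_pMl// -/c mulrC divfK// gt_eqF.
Qed.

End Psi.

Theorem theorem3 (R : realType) (n m : nat) (I : set R) (f : R -> R)
    (g : 'I_n.+1 -> R -> R) (h : 'I_m.+1 -> R -> R)
    (I_nonempty : I !=set0) (I_compact : compact I)
    (f_cont : continuous f)
    (g_cont : forall i, {within I, continuous (g i)})
    (h_cont : forall j, {within I, continuous (h j)}) :
  pseudo_convex_on (feasible I h) (Psi I f g h) /\
  pseudo_monotone_on (feasible I h) (clarke_subdiff (Psi I f g h)).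
Proof.
have pc : pseudo_convex_on (feasible I h) (Psi I f g h).
  exact: Psi_pseudo_convex.
split=> // x y u v xC yC ux vy u0.
have xy := pc x y xC yC (ex_intro2 _ _ u ux u0).
have yx0 := clarke_dderiv_Psi_le0 _ _ _ _ _ _ _
  I_nonempty I_compact f_cont g_cont h_cont y x yC xC xy.
have := le_trans (vy (x - y)) yx0.
by rewrite lee_fin -opprB /pairing /= !dotNr -opprD oppr_le0.
Qed.
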